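(* Let $I\subset(0,\infty)$ be an interval, let $f:I\to\mathbb{R}$ be differentiable on $I^{\circ}$, and let $a,b\in I$ with $a<b$, where $f'$ exists at every point of $[a,b]$ (one-sided derivative at $a$ or $b$ if that point is an endpoint of $I$), and $f'\in L[a,b]$. Let $q>1$, $\frac1p+\frac1q=1$, and suppose $|f'|^q$ is harmonically convex on $[a,b]$. Then $$\left|\frac13\left[\frac{f(a)+f(b)}{2}+2f\left(\frac{2ab}{a+b}\right)\right]-\frac{ab}{b-a}\int_a^b\frac{f(x)}{x^2}\,dx\right|\le\frac{ab(b-a)}{4\left(3^{p+1}(p+1)\right)^{1/p}}\cdot\frac{\left(1+2^{p+1}\right)^{1/p}}{\left[(1-q)(1-2q)(b-a)^2\right]^{1/q}}$$ $$\times\Big\{\big(C_5(q;a,b)|f'(a)|^q+C_6(q;a,b)|f'(b)|^q\big)^{\frac1q}+\big(C_6(q;b,a)|f'(a)|^q+C_5(q;b,a)|f'(b)|^q\big)^{\frac1q}\Big\},$$ where, for $u,\vartheta>0$, $$C_5(q;u,\vartheta)=\left(\frac{u+\vartheta}{2}\right)^{1-2q}\left[\frac{\vartheta-3u}{2}-q(\vartheta-u)\right]+u^{2-2q},$$ $$C_6(q;u,\vartheta)=\left(\frac{u+\vartheta}{2}\right)^{1-2q}\left[\frac{3\vartheta-u}{2}-q(\vartheta-u)\right]+u^{1-2q}\left[u-2\vartheta+2q(\vartheta-u)\right].$$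
   Context: A function $g:J\to\mathbb{R}$ on an interval $J\subset\mathbb{R}\setminus\{0\}$ is harmonically convex if $g\left(\frac{xy}{tx+(1-t)y}\right)\le t\,g(y)+(1-t)\,g(x)$ for all $x,y\in J$ and $t\in[0,1]$. $L[a,b]$ denotes the Lebesgue integrable functions on $[a,b]$. *)

(* Defs.v *)
From HB Require Import structures.
From mathcomp Require Import all_boot all_order all_algebra.
From mathcomp Require Import all_classical all_reals all_analysis.

Set Implicit Arguments.
Unset Strict Implicit.
Unset Printing Implicit Defensive.

Import Order.TTheory GRing.Theory Num.Theory.
Import numFieldNormedType.Exports.

Local Open Scope classical_set_scope.
Local Open Scope ring_scope.

Definition harmonically_convex (R : realType) (J : interval R) (g : R -> R) :=
  0 \notin J /\
  forall x y t : R, x \in J -> y \in J -> 0 <= t <= 1 ->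
    g (x * y / (t * x + (1 - t) * y)) <= t * g y + (1 - t) * g x.

(* Functions on an interval I are total functions R -> R whose values outside
   I are ignored: the difference quotient at x is taken along points of I only,
   so its limit is the usual derivative at interior points of I and the
   one-sided derivative at an endpoint belonging to I. *)
Definition derivable_within (R : realType) (I : interval R) (f : R -> R)
    (x : R) : Prop :=
  cvg ((f y - f x) / (y - x) @[y --> within [set` I] x^']).

Definition derive_within (R : realType) (I : interval R) (f : R -> R)
    (x : R) : R :=
  lim ((f y - f x) / (y - x) @[y --> within [set` I] x^']).

Definition C5 (R : realType) (q u v : R) : R :=
  ((u + v) / 2) `^ (1 - 2 * q) * ((v - 3 * u) / 2 - q * (v - u))
  + u `^ (2 - 2 * q).

Definition C6 (R : realType) (q u v : R) : R :=
  ((u + v) / 2) `^ (1 - 2 * q) * ((3 * v - u) / 2 - q * (v - u))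
  + u `^ (1 - 2 * q) * (u - 2 * v + 2 * q * (v - u)).

(* Main.v *)
Require Import Defs.
From HB Require Import structures.
From mathcomp Require Import all_boot all_order all_algebra.
From mathcomp Require Import all_classical all_reals all_analysis.
From mathcomp Require Import ring lra.

Import Order.TTheory GRing.Theory Num.Theory.
Import numFieldNormedType.Exports.

Local Open Scope classical_set_scope.
Local Open Scope ring_scope.

(* For {u, v} = {a, b}, put A(t) = u + t (v - u) and g(t) = f (u v / A(t)).
   Integrating (2 t - 1/3) g'(t) by parts over [0, 1/2] gives
     2/3 f(2uv/(u+v)) + 1/3 f(v) - 2 int_0^(1/2) g,
   and adding the cases (u, v) = (a, b) and (b, a) gives twice the left-hand
   side. Harmonic convexity yields
     |g'(t)| <= uv |v-u| A(t)^-2 (t |f'(u)|^q + (1-t) |f'(v)|^q)^(1/q),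
   and Hoelder's inequality then produces the p-th moment of |2 t - 1/3| and
   the moments of t and 1 - t against A(t)^(-2q), which are C5 and C6 up to a
   factor. Integrals of f' are avoided: since the bound on |g'| has explicit
   primitives, everything follows from the mean value theorem applied to
   (2 t - 1/3) g(t) - 2 int_0^t g, so only pointwise values of f' matter. *)

(** * Increment inequalities from the mean value theorem *)

Lemma increment_ge0 (R : realType) (psi dpsi : R -> R) (c d : R) :
  c < d ->
  (forall x, x \in `]c, d[ -> is_derive x 1 psi (dpsi x)) ->
  {within `[c, d], continuous psi} ->
  (forall x, x \in `]c, d[ -> 0 <= dpsi x) -> 0 <= psi d - psi c.
Proof.
move=> cd psi_dpsi psi_cont dpsi_ge0.
have [x xcd ->] := MVT cd psi_dpsi psi_cont.
by rewrite mulr_ge0 ?dpsi_ge0// subr_ge0 ltW.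
Qed.

(** The bound on [dphi] says that [psi - phi] and [psi + phi] both have nonnegative derivatives, so
    neither decreases from [c] to [d]. *)
Lemma norm_increment_le (R : realType) (phi dphi psi dpsi : R -> R) (c d : R) :
  c < d ->
  (forall x, x \in `]c, d[ -> is_derive x 1 phi (dphi x)) ->
  (forall x, x \in `]c, d[ -> is_derive x 1 psi (dpsi x)) ->
  {within `[c, d], continuous phi} -> {within `[c, d], continuous psi} ->
  (forall x, x \in `]c, d[ -> `|dphi x| <= dpsi x) ->
  `|phi d - phi c| <= psi d - psi c.
Proof.
move=> cd phiD psiD phi_cont psi_cont dphi_le.
have sub_ge0 : 0 <= (psi - phi) d - (psi - phi) c.
  apply: (@increment_ge0 _ _ (dpsi - dphi)) => //.
  - by move=> x xcd; apply: is_deriveB; [exact: psiD|exact: phiD].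
  - exact: within_continuousB.
  - move=> x /dphi_le; rewrite ler_norml => /andP[_].
    by rewrite -[X in 0 <= X]/(dpsi x - dphi x) subr_ge0.
have add_ge0 : 0 <= (psi + phi) d - (psi + phi) c.
  apply: (@increment_ge0 _ _ (dpsi + dphi)) => //.
  - by move=> x xcd; apply: is_deriveD; [exact: psiD|exact: phiD].
  - exact: within_continuousD.
  - move=> x /dphi_le; rewrite ler_norml => /andP[+ _].
    by rewrite -[X in _ -> 0 <= X]/(dpsi x + dphi x); lra.
move: sub_ge0 add_ge0.
rewrite -[(psi - phi) d]/(psi d - phi d) -[(psi - phi) c]/(psi c - phi c).
rewrite -[(psi + phi) d]/(psi d + phi d) -[(psi + phi) c]/(psi c + phi c).
by move=> *; rewrite ler_norml; apply/andP; split; lra.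
Qed.

(* Hoelder's inequality for antiderivatives: Young's inequality is applied to
   the derivatives, normalized by the increments of K and M. *)
Lemma hoelder_increment (R : realType) (p q c d : R)
    (phi dphi K dK M dM : R -> R) :
  0 < p -> 0 < q -> p^-1 + q^-1 = 1 -> c < d ->
  (forall x, x \in `]c, d[ -> is_derive x 1 phi (dphi x)) ->
  (forall x, x \in `]c, d[ -> is_derive x 1 K (dK x)) ->
  (forall x, x \in `]c, d[ -> is_derive x 1 M (dM x)) ->
  {within `[c, d], continuous phi} -> {within `[c, d], continuous K} ->
  {within `[c, d], continuous M} ->
  (forall x, x \in `]c, d[ -> 0 <= dK x) ->
  (forall x, x \in `]c, d[ -> 0 <= dM x) ->
  (forall x, x \in `]c, d[ -> `|dphi x| <= dK x `^ p^-1 * dM x `^ q^-1) ->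
  0 < K d - K c ->
  `|phi d - phi c| <= (K d - K c) `^ p^-1 * (M d - M c) `^ q^-1.
Proof.
move=> p0 q0 pq cd phiD KD MD phi_cont K_cont M_cont dK0 dM0 dphi_le P0.
set P := K d - K c in P0 *; set Q := M d - M c.
have Q0 : 0 <= Q by apply: (increment_ge0 _ M dM).
set X := `|phi d - phi c|.
rewrite leNgt; apply/negP => ltX.
have P'0 : 0 < P `^ p^-1 by rewrite powR_gt0.
have lt_XP : Q `^ q^-1 < X / P `^ p^-1 by rewrite ltr_pdivlMr// mulrC.
have XP0 : 0 < X / P `^ p^-1 by rewrite (le_lt_trans _ lt_XP)// powR_ge0.
(* Under the negated claim, [Q'] is the value that would turn the inequality into an equality. It
   exceeds [Q], hence is positive even when [Q = 0], and can safely serve as normalizer for [dM]. *)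
pose Q' := (X / P `^ p^-1) `^ q.
have Q'0 : 0 < Q' by rewrite powR_gt0.
have ltQ : Q < Q'.
  have := gt0_ltr_powR q0 (powR_ge0 Q q^-1) (ltW XP0) lt_XP.
  by rewrite -powRrM mulVf ?gt_eqF// powRr1.
have X_eq : X = P `^ p^-1 * Q' `^ q^-1.
  by rewrite /Q' -powRrM mulfV ?gt_eqF// powRr1 ?ltW// mulrC divfK// gt_eqF.
have X0 : 0 < X by rewrite X_eq mulr_gt0 ?powR_gt0.
have : X <= X / (p * P) * P + X / (q * Q') * Q.
  pose psi := X / (p * P) \*: K + X / (q * Q') \*: M.
  have -> : X / (p * P) * P + X / (q * Q') * Q = psi d - psi c.
    rewrite -[psi d]/(X / (p * P) * K d + X / (q * Q') * M d).
    rewrite -[psi c]/(X / (p * P) * K c + X / (q * Q') * M c).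
    by rewrite /P /Q; ring.
  apply: (@norm_increment_le _ phi dphi psi
    (fun x => X / (p * P) * dK x + X / (q * Q') * dM x)) => //.
  - by move=> x xcd; apply: is_deriveD; apply: is_deriveZ;
      [exact: KD|exact: MD].
  - apply: within_continuousD => x; apply: cvgZr; [exact: K_cont|exact: M_cont].
  - move=> x xcd; apply: (le_trans (dphi_le x xcd)).
    have kx := dK0 x xcd; have mx := dM0 x xcd.
    (* Young's inequality multiplied by [X]: as [X] equals [P^(1/p) Q'^(1/q)], the normalizers
       cancel on the left and leave exactly the bound on [dphi]. *)
    have := @conjugate_powR _ ((dK x / P) `^ p^-1) ((dM x / Q') `^ q^-1) p q
      (powR_ge0 _ _) (powR_ge0 _ _) p0 q0 pq.
    rewrite -2!powRrM !mulVf ?gt_eqF// !powRr1 ?divr_ge0//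
      ?(ltW P0) ?(ltW Q'0)//.
    move=> /(ler_wpM2l (ltW X0)).
    rewrite {1}X_eq mulrACA -powRM ?(ltW P0) ?divr_ge0// ?(ltW P0)//.
    rewrite -powRM ?(ltW Q'0) ?divr_ge0// ?(ltW Q'0)//.
    rewrite ![_ * (_ / _)]mulrC !divfK ?gt_eqF//.
    move=> /le_trans; apply; rewrite le_eqVlt; apply/orP; left; apply/eqP.
    by field; rewrite !gt_eqF.
(* Since [1/p + 1/q = 1], the inequality reduces to [1 <= Q / Q'], against [Q < Q']. *)
have -> : X / (p * P) * P + X / (q * Q') * Q = X * (p^-1 + q^-1 * (Q / Q')).
  by field; rewrite !gt_eqF.
rewrite -{1}[X]mulr1 ler_pM2l// -pq lerD2l -{1}[q^-1]mulr1 ler_pM2l ?invr_gt0//.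
by rewrite ler_pdivlMr// mul1r leNgt ltQ.
Qed.

(** * Derivatives, relative continuity and antiderivatives *)

Lemma is_derive_near (R : realType) (g h : R -> R) (x l : R) :
  {near nbhs x, g =1 h} -> is_derive x 1 g l -> is_derive x 1 h l.
Proof.
move=> gh [dg <-]; split; first exact: near_eq_derivable dg.
by apply/esym/near_eq_derive.
Qed.

(** Supplies an antiderivative of [|y|^p] valid across the sign change at 0. The kernel [2 t - 1/3]
    vanishes at [1/6], inside the range of integration, so this avoids splitting there. *)
Lemma is_derive_mulr_norm_powR (R : realType) (p x : R) : 0 < p ->
  is_derive x 1 (fun y => y * `|y| `^ p) ((p + 1) * `|x| `^ p).
Proof.
move=> p0; have [x0|x0|->] := ltgtP x 0.
- apply: (@is_derive_near _ (fun y => y * (- y) `^ p)).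
    near=> y; rewrite ltr0_norm//; near: y; exact: lt_nbhsl.
  have Nx0 : 0 < - x by lra.
  have dN : is_derive x 1 (fun y : R => - y) (- 1) by exact: is_deriveNid.
  have dP : is_derive (- x) 1 (@powR R ^~ p) (p * (- x) `^ (p - 1)).
    exact: is_derive1_powR.
  have dc := @is_derive1_comp _ (@powR R ^~ p) (fun y : R => - y) x _ _ dP dN.
  apply: is_derive_eq (is_deriveM (is_derive_id x 1) dc) _ => /=.
  rewrite ltr0_norm// /GRing.scale/= -(mulr_powRB1 (ltW Nx0) p0).
  ring.
- apply: (@is_derive_near _ (fun y => y * y `^ p)).
    near=> y; rewrite gtr0_norm//; near: y; exact: lt_nbhsr.
  have dP : is_derive x 1 (@powR R ^~ p) (p * x `^ (p - 1)).
    exact: is_derive1_powR.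
  apply: is_derive_eq (is_deriveM (is_derive_id x 1) dP) _ => /=.
  rewrite gtr0_norm// /GRing.scale/= -(mulr_powRB1 (ltW x0) p0).
  ring.
- have cv : h^-1 *: ((h *: (1 : R) + 0) * `|h *: (1 : R) + 0| `^ p
                      - 0 * `|0 : R| `^ p)
      @[h --> (0:R)^'] --> (p + 1) * `|0 : R| `^ p.
    rewrite normr0 powR0 ?gt_eqF// mulr0.
    apply/cvgrPdist_lt => e e0; near=> h => /=.
    have h0 : h != 0 by near: h; exact: nbhs_dnbhs_neq.
    rewrite mulr0 subr0 addr0 sub0r normrN /GRing.scale/= mulr1.
    rewrite mulrA mulVf// mul1r.
    rewrite ger0_norm ?powR_ge0//.
    (* At 0 the difference quotient is [|h|^p]; it stays below [e] as soon as [|h| < e^(1/p)]. *)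
    have -> : e = (e `^ p^-1) `^ p.
      by rewrite -powRrM mulVf ?gt_eqF// powRr1// ltW.
    rewrite gt0_ltr_powR ?nnegrE ?powR_ge0//.
    near: h; apply: dnbhs0_lt; exact: powR_gt0.
  split; first by apply/cvg_ex; exists ((p + 1) * `|0 : R| `^ p).
  exact/cvg_lim.
Unshelve. all: by end_near. Qed.

Lemma within_continuous_comp_within (T U V : topologicalType)
    (A : set T) (B : set U) (g : T -> U) (f : U -> V) :
  {homo g : x / A x >-> B x} ->
  {within A, continuous g} -> {within B, continuous f} ->
  {within A, continuous (f \o g)}.
Proof.
move=> gAB /subspace_continuousP g_cont /subspace_continuousP f_cont.
apply/subspace_continuousP => x Ax.
apply: (@cvg_comp _ _ _ _ _ _ (within B (nbhs (g x)))); last first.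
  exact: f_cont (gAB _ Ax).
move=> W BW.
have gW : \forall y \near x, A y -> B (g y) -> W (g y).
  exact: g_cont x Ax _ BW.
suff : \forall y \near x, A y -> W (g y) by [].
by apply: filterS gW => y ABW Ay; exact: ABW (gAB _ Ay).
Qed.

(** The witness is the running integral from [a]; the fundamental theorem of calculus gives its
    derivative. This trades the Lebesgue integral for an increment, to which the mean value theorem
    applies. *)
Lemma within_continuous_antiderivative (R : realType) (h : R -> R) (a b : R) :
  a < b -> {within `[a, b], continuous h} ->
  exists F : R -> R,
  [/\ {within `[a, b], continuous F},
      forall x, x \in `]a, b[ -> is_derive x 1 F (h x) &
      \int[lebesgue_measure]_(x in `[a, b]) h x = F b - F a].
Proof.
move=> ab h_cont.
have h_int : lebesgue_measure.-integrable `[a, b] (EFin \o h).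
  by apply: continuous_compact_integrable => //; exact: segment_compact.
exists (fun x => \int[lebesgue_measure]_(t in `[a, x]) h t); split.
- exact: (parameterized_integral_continuous (ltW ab) h_int).
- move=> x xab.
  have [ax xb] : a < x /\ x < b by move: xab; rewrite in_itv/= => /andP[].
  have [dF F'h] := continuous_FTC1_closed xb h_int ax
    (within_continuous_continuous ab h_cont xab).
  split; first exact: dF.
  by rewrite -derive1E; exact: F'h.
- by rewrite set_itv1 Rintegral_set1 subr0.
Qed.

(** When [I] is a neighbourhood of [x], restricting the punctured filter at [x] to [I] changes
    nothing near [x]; the rest is the translation [y = h + x]. *)
Lemma derivable_within_is_derive (R : realType) (I : interval R) (f : R -> R)
    (x : R) :
  nbhs x [set` I] -> derivable_within I f x ->
  is_derive x 1 f (derive_within I f x).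
Proof.
move=> Ix dfx.
suff cv : h^-1 *: (f (h *: (1 : R) + x) - f x) @[h --> (0:R)^'] -->
    derive_within I f x.
  split; first by apply/cvg_ex; exists (derive_within I f x).
  exact/cvg_lim.
pose quot y := (f y - f x) / (y - x).
rewrite (_ : (fun h => _) = quot \o (fun h => h + x)); last first.
  apply/funext => h; rewrite /quot/= /GRing.scale/= mulr1 addrK.
  by rewrite mulrC.
apply: (@cvg_comp _ _ _ _ quot _ (within [set` I] x^')) dfx => W /= IW.
have {}IW : \forall y \near x, y != x -> [set` I] y -> W y by exact: IW.
rewrite (near_shift 0) in IW.
have := Ix; rewrite -[nbhs x [set` I]]/(\forall y \near x, [set` I] y).
rewrite (near_shift 0) => Ix0.
near=> h => /=.
have : [set` I] (h + x).
  near: h; apply: nbhs_dnbhs.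
  by move: Ix0; apply: filterS => h /=; rewrite subr0.
have hx : h + x != x by rewrite -subr_eq0 addrK; near: h; exact: nbhs_dnbhs_neq.
move: hx; near: h; apply: nbhs_dnbhs.
by move: IW; apply: filterS => h /=; rewrite subr0.
Unshelve. all: by end_near. Qed.


(** Near [x] the difference quotient is bounded by [|l| + 1], with [l] its limit, so
    [|f y - f x| <= (|l| + 1) |y - x|]. One-sided endpoints are covered as well. *)
Lemma derivable_within_continuous_within (R : realType) (I : interval R)
    (f : R -> R) (A : set R) :
  A `<=` [set` I] -> (forall x, A x -> derivable_within I f x) ->
  {within A, continuous f}.
Proof.
move=> AI df; apply/subspace_continuousP => x Ax.
have := df x Ax; rewrite /derivable_within => /cvgrPdist_lt/(_ 1 ltr01) dfx.
set l := lim _ in dfx.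
apply/cvgrPdist_lt => e e0.
have {}dfx : \forall y \near x, y != x -> [set` I] y ->
  `|l - (f y - f x) / (y - x)| < 1 by exact: dfx.
have C0 : 0 < `|l| + 1 by rewrite ltr_pwDr.
have : \forall y \near x, A y -> `|f x - f y| < e; last by [].
near=> y => Ay.
have [->|yx] := eqVneq y x; first by rewrite subrr normr0.
have q_lt : `|l - (f y - f x) / (y - x)| < 1.
  by move: yx (AI _ Ay); near: y.
have {}q_lt : `|(f y - f x) / (y - x)| < `|l| + 1.
  have := ler_normB l (l - (f y - f x) / (y - x)).
  by rewrite subKr => /le_lt_trans; apply; rewrite ltrD2l.
have yx0 : y - x != 0 by rewrite subr_eq0.
rewrite distrC -(divfK yx0 (f y - f x)) normrM.
have xy_lt : `|x - y| < e / (`|l| + 1).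
  near: y; apply/nbhs_ballP.
  by exists (e / (`|l| + 1)) => //=; rewrite divr_gt0.
rewrite distrC in xy_lt.
apply: (@le_lt_trans _ _ ((`|l| + 1) * `|y - x|)).
  by rewrite ler_wpM2r// ltW.
by rewrite mulrC -ltr_pdivlMr.
Unshelve. all: by end_near. Qed.

(** * Moments of [t] and [1 - t] against [A(t)^(-2q)] *)

Lemma is_derive_affine (R : realType) (u c t : R) :
  is_derive t 1 (fun s => u + s * c) c.
Proof.
have cD (k : R) : is_derive t (1 : R) (fun _ : R => k) (0 : R).
  exact: is_derive_cst.
have := is_deriveD (cD u) (is_deriveM (is_derive_id t 1) (cD c)).
by rewrite /GRing.scale/= mulr0 !add0r mulr1.
Qed.

(** From [t = (A - u) / (v - u)] and [1 - t = (v - A) / (v - u)], both integrands are combinations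
    of [A^(1-2q)] and [A^(-2q)]. Integrating these powers produces the divisors [2 - 2q], [1 - 2q]
    and [(v - u)^2], whose product is [2 * D]. *)
Lemma weighted_moment_antiderivatives (R : realType) (q u v : R) :
  1 < q -> 0 < u -> 0 < v -> u != v ->
  let A t := u + t * (v - u) in
  let D := (1 - q) * (1 - 2 * q) * (v - u) ^+ 2 in
  exists N1 N2 : R -> R,
  [/\ forall t, 0 < A t -> is_derive t 1 N1 (t * A t `^ (- (2 * q))),
      forall t, 0 < A t -> is_derive t 1 N2 ((1 - t) * A t `^ (- (2 * q))),
      N1 (1 / 2) - N1 0 = C5 q u v / (2 * D) &
      N2 (1 / 2) - N2 0 = C6 q u v / (2 * D)].
Proof.
move=> q1 u0 v0 uv A D.
have vu : v - u != 0 by rewrite subr_eq0 eq_sym.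
have q1' : 1 - q != 0 by rewrite lt_eqF//; lra.
have q2' : 1 - 2 * q != 0 by rewrite lt_eqF//; lra.
pose E1 t := A t `^ (1 - 2 * q) / (1 - 2 * q) / (v - u) ^+ 2.
pose E2 t := A t `^ (2 - 2 * q) / (2 - 2 * q) / (v - u) ^+ 2.
have AD (t : R) : is_derive t 1 A (v - u) by exact: is_derive_affine.
have powD r t : r != 0 -> 0 < A t ->
    is_derive t 1 (fun s => A s `^ r / r / (v - u) ^+ 2)
      (A t `^ (r - 1) / (v - u)).
  move=> r0 At.
  have dP : is_derive (A t) 1 (@powR R ^~ r) (r * (A t) `^ (r - 1)).
    exact: is_derive1_powR.
  have dc := @is_derive1_comp _ (@powR R ^~ r) A t _ _ dP (AD t).
  rewrite (_ : (fun s => _)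
      = (r^-1 / (v - u) ^+ 2) \*: (@powR R ^~ r \o A)); last first.
    by apply/funext => s /=; rewrite /GRing.scale/=; ring.
  apply: is_derive_eq (is_deriveZ (r^-1 / (v - u) ^+ 2) dc) _.
  by rewrite /GRing.scale/=; field; rewrite r0 vu.
have E1D t : 0 < A t -> is_derive t 1 E1 (A t `^ (- (2 * q)) / (v - u)).
  move=> At; apply: is_derive_eq (powD _ _ q2' At) _.
  by congr (_ `^ _ / _); ring.
have E2D t : 0 < A t -> is_derive t 1 E2 (A t * A t `^ (- (2 * q)) / (v - u)).
  move=> At; apply: is_derive_eq (powD _ _ _ At) _.
    by rewrite lt_eqF//; lra.
  rewrite -{2}[A t]powRr1 ?ltW// -powRD; last by rewrite (gt_eqF At) implybT.
  by congr (_ `^ _ / _); ring.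
have A0 : A 0 = u by rewrite /A mul0r addr0.
have A2 : A (1 / 2) = (u + v) / 2 by rewrite /A; field.
have m0 : 0 < (u + v) / 2 by lra.
(* With every power written through exponent [1 - 2q], the evaluations become rational identities
   that [field] can settle. *)
have powR_2 x : 0 < x -> x `^ (2 - 2 * q) = x * x `^ (1 - 2 * q).
  move=> x0; rewrite -{2}[x]powRr1 ?ltW// -powRD; last first.
    by rewrite (gt_eqF x0) implybT.
  by congr (_ `^ _); ring.
exists (E2 \- u \*: E1), (v \*: E1 \- E2); split.
- move=> t At.
  apply: is_derive_eq (is_deriveB (E2D t At) (is_deriveZ u (E1D t At))) _.
  by rewrite /GRing.scale/= /A; field.
- move=> t At.
  apply: is_derive_eq (is_deriveB (is_deriveZ v (E1D t At)) (E2D t At)) _.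
  by rewrite /GRing.scale/= /A; field.
- rewrite /= /GRing.scale/= /E1 /E2 A0 A2 /C5 /D !powR_2//.
  by field; rewrite vu q1' q2' /= lt_eqF//; lra.
- rewrite /= /GRing.scale/= /E1 /E2 A0 A2 /C6 /D !powR_2//.
  by field; rewrite vu q1' q2' /= lt_eqF//; lra.
Qed.

(** * Bounds over half of the parameter interval *)

Lemma powR_div (R : realType) (x y r : R) :
  0 <= x -> 0 < y -> (x / y) `^ r = x `^ r / y `^ r.
Proof.
move=> x0 y0; apply: (canRL (mulfK _)); first by rewrite gt_eqF// powR_gt0.
by rewrite -powRM ?divr_ge0// ?(ltW y0)// divfK// gt_eqF.
Qed.

(** Hoelder's inequality for the kernel [2 t - 1/3], with the harmonic substitution abstracted away:
    [alpha] and [beta] stand for [|f'(u)|^q] and [|f'(v)|^q], and [G] for an antiderivative of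
    [g]. *)
Lemma half_interval_bound (R : realType) (p q u v alpha beta : R)
    (g dg G : R -> R) :
  0 < p -> 1 < q -> p^-1 + q^-1 = 1 -> 0 < u -> 0 < v -> u != v ->
  0 <= alpha -> 0 <= beta ->
  {within `[0, 1 / 2], continuous g} -> {within `[0, 1 / 2], continuous G} ->
  (forall t : R, t \in `]0, 1 / 2[ -> is_derive t 1 G (g t)) ->
  (forall t : R, t \in `]0, 1 / 2[ -> is_derive t 1 g (dg t)) ->
  (forall t : R, t \in `]0, 1 / 2[ ->
    `|dg t| <= u * v * `|v - u| / (u + t * (v - u)) ^+ 2
               * (t * alpha + (1 - t) * beta) `^ q^-1) ->
  `|2 / 3 * g (1 / 2) + 1 / 3 * g 0 - 2 * (G (1 / 2) - G 0)|
  <= u * v * `|v - u| / 2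
     * ((1 + 2 `^ (p + 1)) `^ p^-1 / (3 `^ (p + 1) * (p + 1)) `^ p^-1)
     * ((C5 q u v * alpha + C6 q u v * beta) `^ q^-1
        / ((1 - q) * (1 - 2 * q) * (v - u) ^+ 2) `^ q^-1).
Proof.
move=> p0 q1 pq u0 v0 uv al0 be0 g_cont G_cont GD gD dg_le.
have q0 : 0 < q by lra.
have vu : v - u != 0 by rewrite subr_eq0 eq_sym.
pose A t := u + t * (v - u).
have A_gt0 (t : R) : 0 <= t <= 1 -> 0 < A t.
  move=> /andP[t0 t1]; have -> : A t = (1 - t) * u + t * v by rewrite /A; ring.
  have [->|t_neq0] := eqVneq t 0; first by rewrite subr0 mul1r mul0r addr0.
  rewrite ltr_wpDl// ?mulr_ge0 ?subr_ge0 ?mulr_gt0 ?(ltW u0)//.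
  by rewrite lt_neqAle eq_sym t_neq0.
have t01 (t : R) : t \in `]0, 1 / 2[ -> 0 <= t <= 1.
  by rewrite in_itv/= => /andP[t0 t2]; apply/andP; split; lra.
have t01' (t : R) : t \in `[0, 1 / 2] -> 0 <= t <= 1.
  by rewrite in_itv/= => /andP[t0 t2]; apply/andP; split; lra.
set D := (1 - q) * _ * _.
have D0 : 0 < D.
  rewrite /D mulr_gt0//; last by rewrite exprn_even_gt0.
  by rewrite nmulr_rgt0; lra.
have [N1 [N2 [N1D N2D N1E N2E]]] :=
  weighted_moment_antiderivatives _ q u v q1 u0 v0 uv.
rewrite -/D in N1E N2E.
set c := u * v * `|v - u|.
have c0 : 0 < c by rewrite !mulr_gt0 ?normr_gt0.
pose s (t : R) := 2 * t - 1 / 3.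
have cD (t c' : R) : is_derive t (1 : R) (fun _ : R => c') (0 : R).
  exact: is_derive_cst.
have sD (t : R) : is_derive t 1 s 2.
  have := is_deriveB (is_deriveZ 2 (is_derive_id t 1)) (cD t (1 / 3)).
  by rewrite /GRing.scale/= mulr1 subr0.
(* Integration by parts in differential form: the term [2 g] from [s * g] cancels the derivative of
   [2 G], leaving [s * dg]. Dividing by [c] removes the constant from the bound on [dg]. *)
pose phi : R -> R := c^-1 \*: (s * g - 2 \*: G).
have phiD (t : R) : t \in `]0, 1 / 2[ ->
    is_derive t 1 phi (c^-1 * (s t * dg t)).
  move=> tI.
  apply: is_derive_eq (is_deriveZ c^-1
    (is_deriveB (is_deriveM (sD t) (gD t tI)) (is_deriveZ 2 (GD t tI)))) _.
  by rewrite /GRing.scale/=; ring.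
have phi_cont : {within `[0, 1 / 2], continuous phi}.
  move=> t; apply: cvgZr; apply: cvgB; last exact: cvgZr (G_cont t).
  apply: cvgM; last exact: g_cont.
  move: t; apply: continuous_in_subspaceT => t _.
  by apply/differentiable_continuous/derivable1_diffP; case: (sD t).
pose K t := (2 * (p + 1))^-1 * (s t * `|s t| `^ p).
have KD (t : R) : is_derive t 1 K (`|s t| `^ p).
  have dP := is_derive_mulr_norm_powR _ p (s t) p0.
  have dc := @is_derive1_comp _ (fun y : R => y * `|y| `^ p) s t _ _ dP (sD t).
  apply: is_derive_eq (is_deriveZ (2 * (p + 1))^-1 dc) _.
  by rewrite /GRing.scale/=; field; rewrite gt_eqF//; lra.
pose M : R -> R := alpha \*: N1 + beta \*: N2.
have MD (t : R) : 0 <= t <= 1 ->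
    is_derive t 1 M ((t * alpha + (1 - t) * beta) * A t `^ (- (2 * q))).
  move=> /A_gt0 At.
  apply: is_derive_eq (is_deriveD (is_deriveZ alpha (N1D t At))
    (is_deriveZ beta (N2D t At))) _.
  by rewrite /GRing.scale/=; ring.
have M_cont : {within `[0, 1 / 2], continuous M}.
  apply: continuous_in_subspaceT => t; rewrite inE/= => /t01' tI.
  by apply/differentiable_continuous/derivable1_diffP; case: (MD t tI).
have K_cont : {within `[0, 1 / 2], continuous K}.
  apply: continuous_in_subspaceT => t _.
  by apply/differentiable_continuous/derivable1_diffP; case: (KD t).
have M'_ge0 (t : R) : t \in `]0, 1 / 2[ ->
    0 <= (t * alpha + (1 - t) * beta) * A t `^ (- (2 * q)).
  move=> /t01 /andP[t0 t1].
  by rewrite mulr_ge0 ?powR_ge0// addr_ge0// mulr_ge0// subr_ge0.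
have half0 : (0 : R) < 1 / 2 by lra.
set W := 3 `^ (p + 1) * (p + 1).
have W0 : 0 < W by rewrite mulr_gt0 ?powR_gt0//; lra.
have s0 : s 0 = - (1 / 3) by rewrite /s; ring.
have s2 : s (1 / 2) = 2 / 3 by rewrite /s; field.
(* The endpoint values [2/3] and [-1/3] of [s] contribute [(2/3)^(p+1)] and [(1/3)^(p+1)], which add
   up because [s |s|^p] is odd in [s]. *)
have dK : K (1 / 2) - K 0 = (1 + 2 `^ (p + 1)) / (2 * W).
  rewrite /K s0 s2 normrN !gtr0_norm ?divr_gt0// !powR_div// /W powR1.
  have p30 : (3 : R) `^ p != 0 by rewrite gt_eqF// powR_gt0.
  have powp1 (x : R) : 0 < x -> x `^ (p + 1) = x `^ p * x.
    move=> x0; rewrite powRD ?powRr1 ?(ltW x0)//.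
    by apply/implyP => _; rewrite gt_eqF.
  rewrite !powp1//.
  by field; rewrite p30/= gt_eqF//; lra.
set S := C5 q u v * alpha + C6 q u v * beta.
have dM : M (1 / 2) - M 0 = S / (2 * D).
  transitivity (alpha * (N1 (1 / 2) - N1 0) + beta * (N2 (1 / 2) - N2 0)).
    by rewrite /M/= !fctE/= /GRing.scale/=; ring.
  by rewrite N1E N2E /S; field; rewrite gt_eqF.
(* The sign is not visible in the closed forms of [C5] and [C6]; it comes from the monotonicity of
   [M]. It is required to distribute the power [1/q] over the quotient. *)
have S0 : 0 <= S.
  have : 0 <= M (1 / 2) - M 0.
    apply: (increment_ge0 _ M _ _ _ half0 _ M_cont M'_ge0).
    by move=> t /t01; exact: MD.
  by rewrite dM pmulr_lge0// invr_gt0 mulr_gt0.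
have powp0 : 0 < 1 + (2 : R) `^ (p + 1) by rewrite addr_gt0 ?powR_gt0.
have : `|phi (1 / 2) - phi 0|
    <= (K (1 / 2) - K 0) `^ p^-1 * (M (1 / 2) - M 0) `^ q^-1.
  apply: (hoelder_increment _ p q _ _ _ _ _ _ _ _ p0 q0 pq half0 phiD
    (fun t _ => KD t) (fun t tI => MD t (t01 t tI))) => //.
  - move=> t tI; have At := A_gt0 t (t01 t tI).
    have be : 0 <= t * alpha + (1 - t) * beta.
      move: (t01 _ tI) => /andP[t0 t1].
      by rewrite addr_ge0// mulr_ge0// subr_ge0.
    (* The roots recover the factors of the bound: [(|s|^p)^(1/p) = |s|] and
       [(A^(-2q))^(1/q) = A^(-2)]. *)
    rewrite -powRrM mulfV ?gt_eqF// powRr1// powRM ?powR_ge0// -powRrM.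
    rewrite mulNr mulfK ?gt_eqF// powRN powR_mulrn ?(ltW At)//.
    rewrite normrM ger0_norm ?invr_ge0 ?(ltW c0)// normrM mulrCA ler_wpM2l//.
    rewrite mulrC ler_pdivrMr// mulrC.
    apply: le_trans (dg_le t tI) _.
    by rewrite -/c -/(A t) mulrAC -!mulrA.
  - by rewrite dK divr_gt0// mulr_gt0.
have W2 : 0 < 2 * W by rewrite mulr_gt0.
have D2 : 0 < 2 * D by rewrite mulr_gt0.
rewrite dK dM (powR_div _ _ _ _ (ltW powp0) W2) (powR_div _ _ _ _ S0 D2).
rewrite (powRM _ _ (ltW W0))// (powRM _ _ (ltW D0))//.
have -> : phi (1 / 2) - phi 0
    = c^-1 * (2 / 3 * g (1 / 2) + 1 / 3 * g 0 - 2 * (G (1 / 2) - G 0)).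
  by rewrite /phi !fctE/= /GRing.scale/= s0 s2; ring.
rewrite normrM gtr0_norm ?invr_gt0// mulrC ler_pdivrMr//.
move=> /le_trans; apply; rewrite le_eqVlt; apply/orP; left; apply/eqP.
(* The factors 2 in [2 * W] and [2 * D] are raised to [1/p] and [1/q]; together they make the single
   2 under [c]. *)
have two : (2 : R) `^ p^-1 * 2 `^ q^-1 = 2.
  by rewrite -powRD pq ?powRr1// oner_eq0.
have -> : c / 2 = c / ((2 : R) `^ p^-1 * 2 `^ q^-1) by rewrite two.
by field; rewrite !gt_eqF ?powR_gt0.
Qed.

(** Specializes the previous estimate to [g(t) = f(X(t))] with [X(t) = uv / A(t)], which runs from
    [v] at [t = 0] to the harmonic mean at [t = 1/2]. Leaving the order of [u] and [v] open lets one
    proof serve both halves. *)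
Lemma harmonic_half_bound (R : realType) (p q a b u v : R) (f df F : R -> R) :
  0 < p -> 1 < q -> p^-1 + q^-1 = 1 -> 0 < a -> a < b ->
  u \in `[a, b] -> v \in `[a, b] -> u != v ->
  {within `[a, b], continuous f} -> {within `[a, b], continuous F} ->
  (forall x : R, x \in `]a, b[ -> is_derive x 1 f (df x)) ->
  (forall x : R, x \in `]a, b[ -> is_derive x 1 F (f x / x ^+ 2)) ->
  harmonically_convex `[a, b] (fun x => `|df x| `^ q) ->
  `|2 / 3 * f (2 * u * v / (u + v)) + 1 / 3 * f v
    - 2 * (u * v / (v - u)) * (F v - F (2 * u * v / (u + v)))|
  <= u * v * `|v - u| / 2
     * ((1 + 2 `^ (p + 1)) `^ p^-1 / (3 `^ (p + 1) * (p + 1)) `^ p^-1)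
     * ((C5 q u v * `|df u| `^ q + C6 q u v * `|df v| `^ q) `^ q^-1
        / ((1 - q) * (1 - 2 * q) * (v - u) ^+ 2) `^ q^-1).
Proof.
move=> p0 q1 pq a0 ab uI vI uv f_cont F_cont fD FD [_ df_convex].
have q0 : 0 < q by lra.
have [au ub] : a <= u /\ u <= b by move: uI; rewrite in_itv/= => /andP[].
have [av vb] : a <= v /\ v <= b by move: vI; rewrite in_itv/= => /andP[].
have u0 : 0 < u by lra.
have v0 : 0 < v by lra.
have vu : v - u != 0 by rewrite subr_eq0 eq_sym.
pose A t := u + t * (v - u).
have A_bounds (t : R) : 0 <= t <= 1 -> a <= A t <= b.
  by move=> /andP[t0 t1]; rewrite /A; apply/andP; split; nra.
have A_gt0 (t : R) : 0 <= t <= 1 -> 0 < A t.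
  by move=> /A_bounds/andP[aA _]; lra.
pose X t := u * v / A t.
have X_cc (t : R) : t \in `[0, 1 / 2] -> X t \in `[a, b].
  rewrite !in_itv/= => /andP[t0 t2].
  have At : 0 < A t by apply: A_gt0; apply/andP; split; lra.
  rewrite /X ler_pdivlMr// ler_pdivrMr// /A.
  (* [X t] is the average of [v] and [u] with weights [(1 - t) u] and [t v], whose sum is [A t];
     this keeps it in [[a, b]]. *)
  have -> : u * v = (1 - t) * u * v + t * u * v by ring.
  have -> : a * (u + t * (v - u)) = (1 - t) * u * a + t * v * a by ring.
  have -> : b * (u + t * (v - u)) = (1 - t) * u * b + t * v * b by ring.
  have w1 : 0 <= (1 - t) * u by rewrite mulr_ge0; lra.
  have w2 : 0 <= t * v by rewrite mulr_ge0; lra.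
  rewrite [t * u * v]mulrAC; apply/andP; split; apply: lerD; exact: ler_wpM2l.
have X_oo (t : R) : t \in `]0, 1 / 2[ -> X t \in `]a, b[.
  rewrite !in_itv/= => /andP[t0 t2].
  have At : 0 < A t by apply: A_gt0; apply/andP; split; lra.
  rewrite /X ltr_pdivlMr// ltr_pdivrMr// /A.
  have -> : u * v = (1 - t) * u * v + t * u * v by ring.
  have -> : a * (u + t * (v - u)) = (1 - t) * u * a + t * v * a by ring.
  have -> : b * (u + t * (v - u)) = (1 - t) * u * b + t * v * b by ring.
  have w1 : 0 < (1 - t) * u by rewrite mulr_gt0; lra.
  have w2 : 0 < t * v by rewrite mulr_gt0; lra.
  (* Either of [u], [v] may be an endpoint, so strictness comes from one term only: the larger point
     lies strictly above [a], the smaller strictly below [b]. *)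
  rewrite [t * u * v]mulrAC; have [uv'|vu'|uv'] := ltgtP u v; last by lra.
  - apply/andP; split.
      by rewrite ltr_leD ?ltr_pM2l ?ler_pM2l//; lra.
    by rewrite ler_ltD ?ltr_pM2l ?ler_pM2l//; lra.
  - apply/andP; split.
      by rewrite ler_ltD ?ltr_pM2l ?ler_pM2l//; lra.
    by rewrite ltr_leD ?ltr_pM2l ?ler_pM2l//; lra.
have t01 (t : R) : t \in `[0, 1 / 2] -> 0 <= t <= 1.
  by rewrite in_itv/= => /andP[t0 t2]; apply/andP; split; lra.
have t01' (t : R) : t \in `]0, 1 / 2[ -> 0 <= t <= 1.
  by rewrite in_itv/= => /andP[t0 t2]; apply/andP; split; lra.
have XD (t : R) : 0 <= t <= 1 ->
    is_derive t 1 X (- (u * v * (v - u)) / A t ^+ 2).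
  move=> /A_gt0 At.
  have AD : is_derive t 1 A (v - u) by exact: is_derive_affine.
  have At0 : A t != 0 by rewrite gt_eqF.
  rewrite (_ : X = (u * v) \*: (fun s => (A s)^-1))//.
  apply: is_derive_eq (is_deriveZ (u * v) (is_deriveV At0 AD)) _.
  by rewrite /GRing.scale/=; field.
have X_cont : {within `[0, 1 / 2], continuous X}.
  apply: continuous_in_subspaceT => t; rewrite inE/= => /t01 tI.
  by apply/differentiable_continuous/derivable1_diffP; case: (XD t tI).
have X_homo : {homo X : t / [set` `[0, 1 / 2]] t >-> [set` `[a, b]] t}.
  exact: X_cc.
have gX_cont : {within `[0, 1 / 2], continuous (f \o X)} :=
  within_continuous_comp_within _ _ _ _ _ _ _ X_homo X_cont f_cont.
have FX_cont : {within `[0, 1 / 2], continuous (F \o X)} :=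
  within_continuous_comp_within _ _ _ _ _ _ _ X_homo X_cont F_cont.
pose g := f \o X.
(* The factor is chosen so that [G' = g]: the derivative of [F] at [X] is [f(X) / X^2], and
   [X^2 A^2 = (uv)^2] absorbs [X']. *)
pose G := (- (u * v / (v - u))) \*: (F \o X).
have X0 : X 0 = v by rewrite /X /A mul0r addr0 mulrC mulKf// gt_eqF.
have X2 : X (1 / 2) = 2 * u * v / (u + v).
  by rewrite /X /A; field; rewrite !gt_eqF//; lra.
pose dg t := df (X t) * (- (u * v * (v - u)) / A t ^+ 2).
have G_cont : {within `[0, 1 / 2], continuous G}.
  by move=> t; apply: cvgZr; exact: FX_cont.
have GD (t : R) : t \in `]0, 1 / 2[ -> is_derive t 1 G (g t).
  move=> tI; have At := A_gt0 t (t01' t tI).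
  have dc := @is_derive1_comp _ F X t _ _ (FD _ (X_oo t tI)) (XD t (t01' t tI)).
  apply: is_derive_eq (is_deriveZ (- (u * v / (v - u))) dc) _.
  by rewrite /GRing.scale/= /g/= /X; field; rewrite vu !gt_eqF.
have gD (t : R) : t \in `]0, 1 / 2[ -> is_derive t 1 g (dg t).
  move=> tI.
  exact: @is_derive1_comp _ f X t _ _ (fD _ (X_oo t tI)) (XD t (t01' t tI)).
have dg_le (t : R) : t \in `]0, 1 / 2[ ->
    `|dg t| <= u * v * `|v - u| / A t ^+ 2
               * (t * `|df u| `^ q + (1 - t) * `|df v| `^ q) `^ q^-1.
  move=> tI; have At := A_gt0 t (t01' t tI).
  have tI01 := t01' t tI.
  have c_ge0 : 0 <= u * v * `|v - u| / A t ^+ 2.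
    by rewrite divr_ge0 ?mulr_ge0 ?exprn_ge0 ?(ltW u0) ?(ltW v0) ?(ltW At).
  rewrite normrM mulrC normrM normrN normrM (gtr0_norm (mulr_gt0 u0 v0)).
  rewrite (ger0_norm (_ : 0 <= (A t ^+ 2)^-1)); last first.
    by rewrite invr_ge0 exprn_ge0// ltW.
  apply: ler_wpM2l => //.
  have -> : `|df (X t)| = (`|df (X t)| `^ q) `^ q^-1.
    by rewrite -powRrM mulfV ?gt_eqF// powRr1.
  (* The arguments are swapped because harmonic convexity puts the weight [t] on its first point in
     the denominator but on its second point in the bound. *)
  have := df_convex v u t vI uI tI01.
  have -> : v * u / (t * v + (1 - t) * u) = X t.
    by rewrite /X /A [v * u]mulrC; congr (_ / _); ring.
  move=> cvx; apply: ge0_ler_powR => //; rewrite ?nnegrE ?powR_ge0//.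
  - by rewrite invr_ge0 ltW.
  - exact: le_trans (powR_ge0 _ _) cvx.
have := half_interval_bound R p q u v _ _ g dg G p0 q1 pq u0 v0 uv
  (powR_ge0 _ _) (powR_ge0 _ _) gX_cont G_cont GD gD dg_le.
have -> : G (1 / 2) - G 0
    = u * v / (v - u) * (F v - F (2 * u * v / (u + v))).
  by rewrite /G/= /GRing.scale/= X0 X2; ring.
have -> : g (1 / 2) = f (2 * u * v / (u + v)) by rewrite /g/= X2.
have -> : g 0 = f v by rewrite /g/= X0.
by rewrite (mulrA 2).
Qed.

(** * Combination of the two halves *)

Theorem corollary9 (R : realType) (I : interval R) (f : R -> R) (a b p q : R)
  (I_pos : forall x, x \in I -> 0 < x)
  (f_derivable : forall x, [set` I]° x -> derivable f x 1)
  (aI : a \in I) (bI : b \in I) (ab : a < b)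
  (f_derivable_ab : forall x, x \in `[a, b] -> derivable_within I f x)
  (f'_integrable : lebesgue_measure.-integrable `[a, b]
                     (fun x => (derive_within I f x)%:E))
  (q_gt1 : 1 < q) (pq : 1 / p + 1 / q = 1)
  (f'_convex : harmonically_convex `[a, b]
                 (fun x => `|derive_within I f x| `^ q)) :
  let f' := derive_within I f in
  `| 1 / 3 * ((f a + f b) / 2 + 2 * f (2 * a * b / (a + b)))
     - a * b / (b - a)
       * \int[lebesgue_measure]_(x in `[a, b]) (f x / x ^+ 2) |
  <= a * b * (b - a) / (4 * (3 `^ (p + 1) * (p + 1)) `^ (1 / p))
     * ((1 + 2 `^ (p + 1)) `^ (1 / p)
        / ((1 - q) * (1 - 2 * q) * (b - a) ^+ 2) `^ (1 / q))
     * ((C5 q a b * `|f' a| `^ q + C6 q a b * `|f' b| `^ q) `^ (1 / q)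
        + (C6 q b a * `|f' a| `^ q + C5 q b a * `|f' b| `^ q) `^ (1 / q)).
Proof.
rewrite !div1r in pq; cbv zeta; set f' := derive_within I f.
rewrite (div1r p) (div1r q).
have a0 := I_pos _ aI.
have b0 := I_pos _ bI.
have ba0 : 0 < b - a by rewrite subr_gt0.
(* From [q > 1], [1/p = 1 - 1/q] is positive, which also excludes [p = 0], where the inverse would
   be 0 by convention. *)
have p0 : 0 < p.
  have q1 : q^-1 < 1 by rewrite invf_lt1//; lra.
  by rewrite -invr_gt0; lra.
have abI : [set` `[a, b]] `<=` [set` I].
  move=> x; rewrite /= in_itv/=.
  exact: (@interval_is_interval _ I a b aI bI).
have f_cont : {within `[a, b], continuous f}.
  exact: derivable_within_continuous_within abI f_derivable_ab.
have fD (x : R) : x \in `]a, b[ -> is_derive x 1 f (f' x).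
  move=> xab; apply: derivable_within_is_derive.
    have : nbhs x [set` `]a, b[] by exact: near_in_itvoo.
    by apply: filterS => y /= /subset_itv_oo_cc; exact: abI.
  by apply: f_derivable_ab; exact: subset_itv_oo_cc.
have h_cont : {within `[a, b], continuous (fun x => f x / x ^+ 2)}.
  move=> x; apply: cvgM; first exact: f_cont.
  move: x; apply: continuous_in_subspaceT => x.
  rewrite inE/= in_itv/= => /andP[ax _].
  have x0 : x != 0 by rewrite gt_eqF// (lt_le_trans a0).
  by apply: cvgV; [rewrite expf_neq0|exact: exprn_continuous].
have [F [F_cont FD ->]] := within_continuous_antiderivative R _ a b ab h_cont.
have aab : a \in `[a, b] by rewrite in_itv/= lexx ltW.
have bab : b \in `[a, b] by rewrite in_itv/= lexx ltW.
have ab_neq : a != b by rewrite lt_eqF.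
have := harmonic_half_bound R p q a b a b f f' F p0 q_gt1 pq a0 ab aab bab
  ab_neq f_cont F_cont fD FD f'_convex.
have := harmonic_half_bound R p q a b b a f f' F p0 q_gt1 pq a0 ab bab aab
  (_ : b != a) f_cont F_cont fD FD f'_convex.
rewrite eq_sym => /(_ ab_neq).
rewrite (_ : 2 * b * a / (b + a) = 2 * a * b / (a + b)); last first.
  by rewrite [b + a]addrC; ring.
rewrite (distrC a b) (_ : (a - b) ^+ 2 = (b - a) ^+ 2); last by ring.
rewrite (gtr0_norm ba0) [b * a]mulrC.
move: (C5 q b a) (C6 q b a) (C5 q a b) (C6 q a b) => c5' c6' c5 c6.
clearbody f'; move: (f' a) (f' b) => f'a f'b.
rewrite (addrC (c5' * _)).
set m := 2 * a * b / (a + b).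
set U := (1 + _) `^ p^-1; set V := _ `^ p^-1.
set S2 := _ `^ q^-1; set D := _ `^ q^-1; set S1 := _ `^ q^-1.
(* The coefficients of the two integral terms are opposite, as [a - b = -(b - a)], so [F m] cancels
   in the sum. *)
have -> : 1 / 3 * ((f a + f b) / 2 + 2 * f m) - a * b / (b - a) * (F b - F a)
    = 1 / 2 *
      (2 / 3 * f m + 1 / 3 * f b - 2 * (a * b / (b - a)) * (F b - F m)
       + (2 / 3 * f m + 1 / 3 * f a - 2 * (a * b / (a - b)) * (F a - F m))).
  by field; rewrite !subr_eq0 ab_neq eq_sym ab_neq.
move=> B2 B1; rewrite normrM gtr0_norm; last by lra.
(* The 4 in the final constant is this [1/2] times the [1/2] present in each half bound. *)
apply: (@le_trans _ _ (1 / 2 * (a * b * (b - a) / 2 * (U / V) * (S1 / D)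
                             + a * b * (b - a) / 2 * (U / V) * (S2 / D)))).
  apply: ler_wpM2l; first by lra.
  exact: le_trans (ler_normD _ _) (lerD B1 B2).
rewrite le_eqVlt; apply/orP; left; apply/eqP.
have V0 : V != 0.
  by rewrite gt_eqF// powR_gt0// mulr_gt0 ?powR_gt0 ?addr_gt0.
have D0 : D != 0.
  rewrite gt_eqF// powR_gt0// mulr_gt0 ?exprn_gt0// nmulr_rgt0; lra.
by field; rewrite V0 D0.
Qed.
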